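(* Let $q\in\mathbb C$ with $0<|q|<1$, $z\in\mathbb C\setminus\{0\}$, $x=\frac12(z+z^{-1})\neq0$, $a,b,c\in\mathbb C\setminus\{0\}$, and let $t\in\mathbb C$ satisfy $|tz|<1$ and $|tz^{-1}|<1$, with $at,bt,ct\notin\{q^{-k}:k\in\mathbb N_0\}$. Then the continuous dual $q$-Hahn polynomials $p_n(x;a,b,c|q)$ satisfy $$\sum_{n=0}^\infty\frac{t^n\,p_n(x;a,b,c|q)}{(q;q)_n}=\frac{(at,bt,ct;q)_\infty}{(tz,tz^{-1};q)_\infty}\;{}_2\phi_3\left(tz,\,tz^{-1};\ at,\,bt,\,ct;\ q,abct\right).$$
   Context: $\mathbb N_0=\{0,1,2,\dots\}$. $(a;q)_n=\prod_{j=0}^{n-1}(1-aq^j)$ for $n\in\mathbb N_0\cup\{\infty\}$, $(a_1,\dots,a_k;q)_n=\prod_i(a_i;q)_n$, and $${}_r\phi_s(a_1,\dots,a_r;b_1,\dots,b_s;q,w)=\sum_{k\ge0}\frac{(a_1,\dots,a_r;q)_k}{(q,b_1,\dots,b_s;q)_k}\left((-1)^kq^{\binom k2}\right)^{1+s-r}w^k .$$ The continuous dual $q$-Hahn polynomials, for $x=\frac12(z+z^{-1})$, are $$p_n(x;a,b,c|q)=a^{-n}(ab,ac;q)_n\;{}_3\phi_2\left(q^{-n},az,az^{-1};ab,ac;q,q\right)$$ (polynomials in $x,a,b,c$, so exceptional parameter values in the formula are understood by continuity). *)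

(* Defs.v *)
From HB Require Import structures.
From mathcomp Require Import all_boot all_order all_algebra.
From mathcomp Require Import all_classical all_reals all_analysis.
From mathcomp Require Export complex.

Set Implicit Arguments.
Unset Strict Implicit.
Unset Printing Implicit Defensive.

Import Order.TTheory GRing.Theory Num.Theory.
Export numFieldNormedType.Exports.

Local Open Scope classical_set_scope.
Local Open Scope ring_scope.
Local Open Scope complex_scope.

(* [R[i]] with the topology and norm it has as a numeric field. *)
HB.instance Definition _ (R : realType) := NormedModule.copy R[i] R[i]^o.

Section QSeries.
Context {K : numFieldType}.
Implicit Types (q a b c w x z : K) (n k : nat).

Definition qpoch q n a : K := \prod_(j < n) (1 - a * q ^+ j).

Definition qpoch_oo q a : K := limn (fun n => qpoch q n a).

Definition qpochs q n (s : seq K) : K := \prod_(a <- s) qpoch q n a.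

Definition qpochs_oo q (s : seq K) : K := \prod_(a <- s) qpoch_oo q a.

(* The exponent [1 + s - r] is an integer, possibly negative.  When some upper
   parameter is [q ^- n], the terms with [k > n] have a zero numerator, hence
   vanish even if their denominator is zero, since [x / 0 = 0]. *)
Definition qhyper_term q (al be : seq K) w k : K :=
  qpochs q k al / qpochs q k (q :: be)
  * ((- 1) ^+ k * q ^+ 'C(k, 2)) ^ (1 + (size be)%:Z - (size al)%:Z)
  * w ^+ k.

Definition qhyper q (al be : seq K) w : K :=
  limn (series (qhyper_term q al be w)).

Definition cdqHahn_formula q n z a b c : K :=
  a ^- n * qpochs q n [:: a * b; a * c]
  * qhyper q [:: q ^- n; a * z; a * z^-1] [:: a * b; a * c] q.

(* The parameters for which no denominator in the formula vanishes. *)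
Definition cdqHahn_regular q n : set (K * K * K) :=
  [set p | [/\ p.1.1 != 0,
               forall k, (k < n)%N -> p.1.1 * p.1.2 * q ^+ k != 1 &
               forall k, (k < n)%N -> p.1.1 * p.2 * q ^+ k != 1]].

(* The formula is invariant under [z <-> z^-1], so any solution [z] of
   [x = (z + z^-1) / 2] may be used. *)
Definition joukowski_inv x : K :=
  xget 1 [set z | z != 0 /\ x = (z + z^-1) / 2].

(* The value at [(a, b, c)] is the limit of the formula along regular
   parameters: this is the formula itself at regular parameters, and its
   extension by continuity at the exceptional ones. *)
Definition cdqHahn q n x a b c : K :=
  lim (cdqHahn_formula q n (joukowski_inv x) p.1.1 p.1.2 p.2
       @[p --> within (cdqHahn_regular q n) (nbhs (a, b, c))]).

End QSeries.

(* Main.v *)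
Require Import Defs.
From mathcomp Require Import all_boot all_order all_algebra.
From mathcomp Require Import all_classical all_reals all_analysis.
From mathcomp Require Import ring lra zify.

Import Order.TTheory GRing.Theory Num.Theory.

Local Open Scope classical_set_scope.
Local Open Scope ring_scope.
Local Open Scope complex_scope.

(** The right-hand side becomes a power series in [t] once its infinite products
    are expanded.  Since [(at; q)_oo / (at; q)_k = (a t q^k; q)_oo], it equals
    [\sum_k q^(k (k - 1)) (abc t)^k / (q; q)_k * G (t q^k)], where
    [G s = (as, bs, cs; q)_oo / (sz, s / z; q)_oo].  Euler's expansions of
    [(x; q)_oo] and [1 / (x; q)_oo] ([abs_sums_qexp], [abs_sums_geom]) turn [G]
    into a Cauchy product of five absolutely convergent power series, and
    collecting the powers of [t] reduces the theorem to a finite identity for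
    each [n] ([cdq_coefE]).  The rearrangement of the double series is
    [series_triangle], a form of Tannery's theorem.

    The finite identity is built up one parameter at a time.  Without [b] and
    [c], it says that the coefficients of [(as; q)_oo / (sz, s / z; q)_oo] are
    the terminating sums of [big_qhermite_coefE]; this is the q-binomial
    inversion of an expansion of [(az, a / z; q)_k], itself a consequence
    of Rothe's q-binomial theorem.  Multiplying a generating function by
    [(bs; q)_oo] multiplies the k-th summand by [(ab q^k; q)_(n-k)]
    ([cauchy_prod_qexp_cdq_weight]); this gives the Al-Salam-Chihara
    polynomials, and [c] is brought in the same way.  What is left is once more
    Rothe's theorem.

    The polynomials themselves are limits of the hypergeometric formula along
    regular parameters.  Clearing the denominators of the formula gives an
    expression that is continuous at every [(a, b, c)] with [a] nonzero, and
    regular parameters accumulate at every such point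
    ([within_regular_proper]), so the limit is the value of that expression
    ([cdqHahnE]).

    The analysis is carried out over any numeric field in which absolutely
    summable sequences have small tails and convergent series; the complex
    numbers have this property ([complex_abs_summable_complete]). *)

(** * Triangular sums and Cauchy products *)

Lemma binS2 k : 'C(k.+1, 2) = ('C(k, 2) + k)%N.
Proof. by rewrite binS bin1 addnC. Qed.

Lemma bin2D i j : 'C(i + j, 2) = ('C(i, 2) + 'C(j, 2) + i * j)%N.
Proof.
elim: i => [|i IHi]; first by rewrite add0n bin0n mul0n addn0.
by rewrite addSn !binS2 IHi mulSn; lia.
Qed.

Section Convolution.
Context {K : numFieldType}.
Implicit Types (u v w : nat -> K).

Definition cauchy_prod u v n : K := \sum_(i < n.+1) u i * v (n - i)%N.

Lemma triangle_swap (X : nat -> nat -> nat -> K) n :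
  \sum_(i < n.+1) \sum_(j < (n - i).+1) X i j (n - i - j)%N =
  \sum_(j < n.+1) \sum_(i < (n - j).+1) X i j (n - i - j)%N.
Proof.
have widen (Y : nat -> K) (i : 'I_n.+1) :
    \sum_(j < (n - i).+1) Y j = \sum_(j < n.+1 | (i + j <= n)%N) Y j.
  rewrite (big_ord_widen n.+1 Y) ?ltnS ?leq_subr//.
  by apply: eq_bigl => j; rewrite ltnS leq_subRL// -ltnS.
under eq_bigr => i _ do rewrite (widen (fun j => X i j (n - i - j)%N)).
rewrite (exchange_big_dep xpredT)//=.
apply: eq_bigr => j _; rewrite (widen (fun i => X i j (n - i - j)%N)).
by apply: eq_bigl => i; rewrite addnC.
Qed.

Lemma triangle_rev (X : nat -> nat -> K) n :
  \sum_(i < n.+1) X i (n - i)%N = \sum_(i < n.+1) X (n - i)%N i.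
Proof.
rewrite (reindex_inj rev_ord_inj)/=; apply: eq_bigr => i _.
by rewrite subSS subKn// -ltnS.
Qed.

(** Both sides sum [X i j m] over [i + j + m = n]; the right-hand side groups the
    terms by [s = i + j], so this is the associativity of Cauchy products in a
    form where [X] need not be a product. *)
Lemma triangle_assoc (X : nat -> nat -> nat -> K) n :
  \sum_(i < n.+1) \sum_(j < (n - i).+1) X i j (n - i - j)%N =
  \sum_(s < n.+1) \sum_(i < s.+1) X i (s - i)%N (n - s)%N.
Proof.
under eq_bigr => i _ do rewrite (triangle_rev (fun j l => X i j l)).
rewrite (triangle_swap (fun i j l => X i l j)).
rewrite [RHS](triangle_rev (fun s t => \sum_(i < s.+1) X i (s - i)%N t)).
by do 2!apply: eq_bigr => ? _; rewrite subnAC.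
Qed.

Lemma cauchy_prod_scale u v s n :
  cauchy_prod (fun k => u k * s ^+ k) (fun k => v k * s ^+ k) n =
  cauchy_prod u v n * s ^+ n.
Proof.
rewrite /cauchy_prod mulr_suml; apply: eq_bigr => i _.
by rewrite -[in s ^+ n](@subnKC i n) -1?ltnS// exprD; ring.
Qed.

End Convolution.

(** * Finite q-identities *)

Section QAlgebra.
Context {K : numFieldType}.
Variable q : K.
Hypotheses (q_neq0 : q != 0) (q_not_root1 : forall k, q ^+ k.+1 != 1).
Implicit Types (a b c x z : K) (n k l : nat) (phi : nat -> K).

Definition inv_qfact k : K := (qpoch q k q)^-1.

(** The coefficients of Euler's expansion of [(x s; q)_oo] in powers of [s]. *)
Definition qexp_coef x k : K := q ^+ 'C(k, 2) * (- x) ^+ k * inv_qfact k.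

Lemma qpoch0 x : qpoch q 0 x = 1.
Proof. by rewrite /qpoch big_ord0. Qed.

Lemma qpochS k x : qpoch q k.+1 x = qpoch q k x * (1 - x * q ^+ k).
Proof. by rewrite /qpoch big_ord_recr. Qed.

Lemma qpochSl k x : qpoch q k.+1 x = (1 - x) * qpoch q k (x * q).
Proof.
rewrite /qpoch big_ord_recl expr0 mulr1; congr (_ * _).
by apply: eq_bigr => i _; rewrite lift0 exprS mulrA.
Qed.

Lemma qpochD m n x : qpoch q (m + n) x = qpoch q m x * qpoch q n (x * q ^+ m).
Proof.
elim: m x => [|m IHm] x; first by rewrite qpoch0 mul1r expr0 mulr1.
by rewrite addSn !qpochSl IHm -!mulrA -exprS.
Qed.

Lemma qpoch_neq0P n x :
  reflect (forall k, (k < n)%N -> x * q ^+ k != 1) (qpoch q n x != 0).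
Proof.
apply: (iffP idP) => [/prodf_neq0 H k kn|H].
  by have /= := H (Ordinal kn) isT; rewrite subr_eq0 eq_sym.
by apply/prodf_neq0 => k _; rewrite subr_eq0 eq_sym H.
Qed.

Lemma qpoch_qq_neq0 k : qpoch q k q != 0.
Proof. by apply/qpoch_neq0P => j _; rewrite -exprS. Qed.

Lemma inv_qfact_neq0 k : inv_qfact k != 0.
Proof. by rewrite invr_eq0 qpoch_qq_neq0. Qed.

Lemma inv_qfact0 : inv_qfact 0 = 1.
Proof. by rewrite /inv_qfact qpoch0 invr1. Qed.

Lemma subq_neq0 k : 1 - q ^+ k.+1 != 0.
Proof. by rewrite subr_eq0 eq_sym. Qed.

Lemma inv_qfactS k : inv_qfact k = inv_qfact k.+1 * (1 - q ^+ k.+1).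
Proof.
by rewrite /inv_qfact qpochS -exprS invfM -mulrA mulVf ?mulr1// subq_neq0.
Qed.

(** Rothe's q-binomial theorem, with the q-binomial coefficients written through
    inverse q-factorials so that it becomes a Cauchy product.  Multiplying by
    [1 - q^(n+1) = q^i (1 - q^(n+1-i)) + (1 - q^i)] lowers the degree: the first
    part yields the sum for [x q], the second [- x] times it. *)
Lemma cauchy_prod_qexp_coef x n :
  cauchy_prod (qexp_coef x) inv_qfact n = qpoch q n x * inv_qfact n.
Proof.
elim: n x => [|n IHn] x.
  rewrite /cauchy_prod big_ord_recl big_ord0 /= /qexp_coef.
  by rewrite !qpoch0 !inv_qfact0 bin0n !expr0; ring.
have: (1 - q ^+ n.+1) * cauchy_prod (qexp_coef x) inv_qfact n.+1 =
      (1 - x) * cauchy_prod (qexp_coef (x * q)) inv_qfact n.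
  pose T k l : K := q ^+ 'C(k, 2) * (- x) ^+ k * q ^+ k * inv_qfact k * inv_qfact l.
  have -> : cauchy_prod (qexp_coef (x * q)) inv_qfact n = \sum_(i < n.+1) T i (n - i)%N.
    apply: eq_bigr => i _; rewrite /qexp_coef /T -mulNr exprMn; ring.
  rewrite [RHS]mulrBl mul1r [x * _]mulr_sumr /cauchy_prod mulr_sumr.
  have -> : \sum_(i < n.+2) (1 - q ^+ n.+1) *
        (qexp_coef x i * inv_qfact (n.+1 - i)) =
      \sum_(i < n.+2) (q ^+ i * (1 - q ^+ (n.+1 - i)%N) *
        (qexp_coef x i * inv_qfact (n.+1 - i))) +
      \sum_(i < n.+2) ((1 - q ^+ i) * (qexp_coef x i * inv_qfact (n.+1 - i))).
    rewrite -big_split/=; apply: eq_bigr => i _.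
    by rewrite -[in q ^+ n.+1](@subnKC i n.+1) -1?ltnS// exprD; ring.
  rewrite big_ord_recr/= subnn expr0 subrr mulr0 mul0r addr0.
  rewrite [X in _ + X]big_ord_recl/= expr0 subrr mul0r add0r.
  congr (_ + _).
    apply: eq_bigr => i _; have in_ : (i <= n)%N by rewrite -ltnS.
    rewrite /T /qexp_coef (subSn in_) (inv_qfactS (n - i)); ring.
  rewrite -sumrN; apply: eq_bigr => i _; rewrite /bump leq0n add1n subSS.
  rewrite /T /qexp_coef (inv_qfactS i) binS2 exprD !exprS; ring.
rewrite IHn => E; apply: (mulfI (subq_neq0 n)).
rewrite E qpochSl (inv_qfactS n); ring.
Qed.

Lemma qpoch_qexpN l k : (k <= l)%N ->
  qpoch q k (q ^- l) * inv_qfact l =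
  (-1) ^+ k * q ^+ 'C(k, 2) / q ^+ (l * k) * inv_qfact (l - k).
Proof.
elim: k => [|k IHk] kl.
  by rewrite qpoch0 muln0 bin0n subn0 !expr0 invr1; ring.
rewrite qpochS mulrAC IHk ?(ltnW kl)//.
move: kl => /subnKC <-; move: (l - k.+1)%N => m {IHk}.
rewrite addSn -addnS !addKn addnS -addSn addKn (inv_qfactS m) binS2 mulnS.
have := expf_neq0 ((k.+1 + m) * k) q_neq0.
move: ((k.+1 + m) * k)%N => p; rewrite !exprD; move: (q ^+ p) => A.
have := expf_neq0 k q_neq0; have := expf_neq0 m q_neq0; rewrite !exprS.
move: (q ^+ 'C(_, 2)) (q ^+ m) (q ^+ k) => B C D *.
by field; apply/and4P.
Qed.

Implicit Types (g : nat -> K).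
Local Notation e := inv_qfact.
Local Notation f := qexp_coef.

Lemma qexp_coefZ x s k : f (x * s) k = f x k * s ^+ k.
Proof. by rewrite /qexp_coef -mulNr exprMn; ring. Qed.

(** The finite form of the q-binomial theorem
    [(as; q)_oo / (sz; q)_oo = \sum_n (a / z; q)_n / (q; q)_n (sz)^n]. *)
Lemma cauchy_prod_qexp_geom a z n : z != 0 ->
  cauchy_prod (f a) (fun k => e k * z ^+ k) n = qpoch q n (a / z) * e n * z ^+ n.
Proof.
move=> z0; rewrite -cauchy_prod_qexp_coef -cauchy_prod_scale.
by apply: eq_bigr => i _; rewrite -qexp_coefZ divfK.
Qed.

Definition inversion_weight l k : K :=
  (-1) ^+ k * q ^+ ('C(k, 2) + k) / q ^+ (l * k) * e (l - k).

(** Exchanging the sums, the coefficient of [g i] is by Rothe's theorem a multiple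
    of [(q^(i+1-l); q)_(l-i)], which has the factor [1 - q^0] unless [i = l]. *)
Lemma qbinomial_inversion g l :
  \sum_(k < l.+1) inversion_weight l k *
    cauchy_prod (fun i => q ^+ 'C(i, 2) * g i) e k = (-1) ^+ l * g l.
Proof.
pose Y i j m : K := (-1) ^+ (i + j) * q ^+ ('C(i + j, 2) + (i + j)) /
  q ^+ (l * (i + j)) * e m * (q ^+ 'C(i, 2) * g i * e j).
transitivity (\sum_(k < l.+1) \sum_(i < k.+1) Y i (k - i)%N (l - k)%N).
  apply: eq_bigr => k _; rewrite mulr_sumr; apply: eq_bigr => i _.
  by rewrite /Y subnKC // -ltnS.
rewrite -triangle_assoc.
have E i : (i <= l)%N -> \sum_(j < (l - i).+1) Y i j (l - i - j)%N =
   (-1) ^+ i * q ^+ (2 * 'C(i, 2) + i) / q ^+ (l * i) * g i *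
   (qpoch q (l - i) (q ^+ i.+1 / q ^+ l) * e (l - i)).
  move=> il; rewrite -cauchy_prod_qexp_coef// mulr_sumr; apply: eq_bigr => j _.
  rewrite /Y /qexp_coef bin2D mulnDr -[- (_ / _)]mulN1r !exprMn exprVn -!exprM.
  rewrite mul2n -addnn mulSn !exprD.
  by field; rewrite !expf_neq0.
rewrite big_ord_recr/= E// subnn qpoch0 inv_qfact0 big1 ?add0r.
  have -> : (l * l = 2 * 'C(l, 2) + l)%N.
    by elim: (l) => // n IHn; rewrite binS2; lia.
  by field; rewrite !expf_neq0.
move=> i _; have il := ltn_ord i; rewrite E ?(ltnW il)//.
have e1 : q ^+ i.+1 / q ^+ l * q ^+ (l - i.+1) = 1.
  by rewrite mulrAC -exprD subnKC// divff ?expf_neq0.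
by rewrite -(subnSK il) qpochS e1 subrr; ring.
Qed.

Definition askey_basis a z k : K := qpoch q k (a * z) * qpoch q k (a / z).

(** The coefficients of [(as; q)_oo / (sz, s / z; q)_oo] in powers of [s]: the
    continuous big q-Hermite polynomials divided by [(q; q)_n]. *)
Definition big_qhermite_coef a z : nat -> K :=
  cauchy_prod (cauchy_prod (f a) (fun k => e k * z ^+ k))
    (fun k => e k * z ^- k).

(** After the first q-binomial sum, the inner sum on the right is Rothe's expansion
    of [(a q^i / z; q)_(k-i)]; it completes [(a / z; q)_i] to [(a / z; q)_k], and
    the outer sum is then Rothe's expansion of [(az; q)_k]. *)
Lemma askey_basis_expansion a z k : z != 0 ->
  askey_basis a z k * e k =
  cauchy_prod
    (fun l => q ^+ 'C(l, 2) * ((- a) ^+ l * big_qhermite_coef a z l)) e k.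
Proof.
move=> z0.
pose Y i j m : K := q ^+ 'C(i + j, 2) * (- a) ^+ (i + j) *
  (qpoch q i (a / z) * e i * z ^+ i) * (e j * z ^- j) * e m.
transitivity (\sum_(l < k.+1) \sum_(i < l.+1) Y i (l - i)%N (k - l)%N); last first.
  apply: eq_bigr => l _; rewrite /big_qhermite_coef {1}/cauchy_prod.
  rewrite 2!mulr_sumr mulr_suml.
  apply: eq_bigr => i _.
  by rewrite cauchy_prod_qexp_geom// /Y subnKC -1?ltnS//; ring.
rewrite -triangle_assoc.
rewrite /askey_basis mulrAC -cauchy_prod_qexp_coef// mulr_suml; apply: eq_bigr => i _.
rewrite -[in qpoch q k _](@subnKC i k) -1?ltnS// qpochD.
transitivity (q ^+ 'C(i, 2) * (- a * z) ^+ i * e i * qpoch q i (a / z) *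
   (qpoch q (k - i) (a / z * q ^+ i) * e (k - i))).
  by rewrite /qexp_coef -mulNr; ring.
rewrite -cauchy_prod_qexp_coef// mulr_sumr; apply: eq_bigr => j _.
rewrite /Y /qexp_coef bin2D -!mulNr !exprMn !exprD exprVn exprM.
by field; rewrite ?expf_neq0.
Qed.

(** [a^-l (q^-l; q)_k q^k / ((q; q)_k (q; q)_l)] with the q-shifted factorial of
    [q^-l] written out. *)
Definition cdq_weight a l k : K := a ^- l * inversion_weight l k * e k.

Lemma big_qhermite_coefE a z l : a != 0 -> z != 0 ->
  big_qhermite_coef a z l = \sum_(k < l.+1) cdq_weight a l k * askey_basis a z k.
Proof.
move=> a0 z0.
transitivity (a ^- l * ((-1) ^+ l * ((- a) ^+ l * big_qhermite_coef a z l))).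
  rewrite -[- a]mulN1r exprMn mulrA -!mulrA; rewrite [X in _ = _ * X]mulrA.
  rewrite -expr2 -exprM mulnC exprM sqrrN expr1n expr1n mul1r.
  by rewrite mulKf ?expf_neq0.
rewrite -(qbinomial_inversion (fun i => (- a) ^+ i * big_qhermite_coef a z i)).
rewrite mulr_sumr; apply: eq_bigr => k _.
by rewrite -askey_basis_expansion// /cdq_weight; ring.
Qed.

(** How a terminating sum changes when its generating function is multiplied by
    [(bs; q)_oo]: for fixed [k] the factors depending on [j] form Rothe's sum for
    [(ab q^k; q)_(l-k)]. *)
Lemma cauchy_prod_qexp_cdq_weight a b phi l : a != 0 ->
  cauchy_prod (f b) (fun m => \sum_(k < m.+1) cdq_weight a m k * phi k) l =
  \sum_(k < l.+1) cdq_weight a l k * qpoch q (l - k) (a * b * q ^+ k) * phi k.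
Proof.
move=> a0.
pose Y j k m : K := f b j * (a ^- (k + m) * ((-1) ^+ k *
  q ^+ ('C(k, 2) + k) / q ^+ ((k + m) * k) * e m) * e k) * phi k.
transitivity (\sum_(j < l.+1) \sum_(k < (l - j).+1) Y j k (l - j - k)%N).
  apply: eq_bigr => j _; rewrite mulr_sumr; apply: eq_bigr => k _.
  by rewrite /Y subnKC -1?ltnS// /cdq_weight /inversion_weight; ring.
rewrite triangle_swap; apply: eq_bigr => k _.
transitivity (a ^- l * (-1) ^+ k * q ^+ ('C(k, 2) + k) / q ^+ (l * k) * e k *
    phi k * (qpoch q (l - k) (a * b * q ^+ k) * e (l - k))); last first.
  by rewrite /cdq_weight /inversion_weight; ring.
rewrite -cauchy_prod_qexp_coef// mulr_sumr; apply: eq_bigr => j _.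
have [m lE] : exists m, l = (k + j + m)%N.
  by exists (l - k - j)%N; have := ltn_ord k; have := ltn_ord j; lia.
rewrite /Y (_ : l - j - k = m)%N; last lia.
rewrite (_ : l - k - j = m)%N; last lia.
rewrite (_ : l * k = (k + m) * k + k * j)%N; last by rewrite {1}lE; lia.
rewrite (_ : a ^- l = a ^- (k + m + j)); last by congr (_ ^- _); lia.
rewrite !exprD /qexp_coef (_ : - (_ * _) = a * - b * q ^+ k); last by ring.
rewrite !exprMn -exprM.
by field; rewrite !expf_neq0.
Qed.

(** The continuous dual q-Hahn polynomial divided by [(q; q)_n], as its
    hypergeometric formula reads after cancelling the denominators
    [(ab, ac; q)_k] against [(ab, ac; q)_n]. *)
Definition cdq_coef a b c z n : K :=
  \sum_(k < n.+1) cdq_weight a n k * qpoch q (n - k) (a * b * q ^+ k) *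
    qpoch q (n - k) (a * c * q ^+ k) * askey_basis a z k.

(** The coefficients of [(as, bs, cs; q)_oo / (sz, s / z; q)_oo]. *)
Definition cdq_product_coef a b c z : nat -> K :=
  cauchy_prod (f c) (cauchy_prod (f b) (big_qhermite_coef a z)).

(** The sums for the parameters [a], [b] are the coefficients of
    [(as, bs; q)_oo / (sz, s / z; q)_oo], the Al-Salam-Chihara polynomials.
    Bringing in [c] is a Cauchy product in which the factor [(ab q^k; q)_(n-k)]
    stays fixed; splitting it as
    [(ab q^k; q)_(n-j-k) (ab q^(n-j); q)_j] recovers the Al-Salam-Chihara sum of
    degree [n - j]. *)
Lemma cdq_coef_al_salam_chihara a b c z n : a != 0 -> z != 0 ->
  cdq_coef a b c z n =
  \sum_(j < n.+1) f c j * qpoch q j (a * b * q ^+ (n - j)) *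
    cauchy_prod (f b) (big_qhermite_coef a z) (n - j).
Proof.
move=> a0 z0.
transitivity (cauchy_prod (f c) (fun m => \sum_(k < m.+1) cdq_weight a m k *
    (qpoch q (n - k) (a * b * q ^+ k) * askey_basis a z k)) n).
  rewrite (cauchy_prod_qexp_cdq_weight a c
    (fun k => qpoch q (n - k) (a * b * q ^+ k) * askey_basis a z k))//.
  by apply: eq_bigr => k _; ring.
apply: eq_bigr => j _.
have -> : big_qhermite_coef a z =
    fun m => \sum_(k < m.+1) cdq_weight a m k * askey_basis a z k.
  by apply/funext => m; exact: big_qhermite_coefE.
rewrite (cauchy_prod_qexp_cdq_weight a b (askey_basis a z))// -mulrA; congr (_ * _).
rewrite mulr_sumr; apply: eq_bigr => k _.
rewrite (_ : n - k = n - j - k + j)%N; last first.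
  by have := ltn_ord k; have := ltn_ord j; lia.
rewrite qpochD -!mulrA -exprD subnKC -1?ltnS//; ring.
Qed.

(** The theorem at the level of the coefficient of [t^n].  For each [s], the terms
    with Al-Salam-Chihara factor of degree [n - s] agree by Rothe's expansion of
    [(ab q^(n-s); q)_s]. *)
Lemma cdq_coefE a b c z n : a != 0 -> z != 0 ->
  cdq_coef a b c z n =
  \sum_(k < n.+1) q ^+ (2 * 'C(k, 2)) * (a * b * c) ^+ k * e k *
    (cdq_product_coef a b c z (n - k) * q ^+ (k * (n - k))).
Proof.
move=> a0 z0; rewrite cdq_coef_al_salam_chihara// /cdq_product_coef.
move: (cauchy_prod (f b) _) => al.
pose Y k i m : K := q ^+ (2 * 'C(k, 2)) * (a * b * c) ^+ k * e k *
   q ^+ (k * (i + m)) * f c i * al m.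
transitivity (\sum_(k < n.+1) \sum_(i < (n - k).+1) Y k i (n - k - i)%N); last first.
  apply: eq_bigr => k _; rewrite /cauchy_prod mulr_suml mulr_sumr.
  by apply: eq_bigr => i _; rewrite /Y subnKC -1?ltnS//; ring.
rewrite triangle_assoc; apply: eq_bigr => s _.
apply: (mulIf (inv_qfact_neq0 s)).
rewrite mulrAC -(mulrA _ (qpoch _ _ _)) -cauchy_prod_qexp_coef/cauchy_prod.
rewrite mulr_sumr 2!mulr_suml.
apply: eq_bigr => k _; rewrite /Y /qexp_coef.
have := ltn_ord k; have := ltn_ord s; rewrite !ltnS => sn ks.
rewrite (_ : k * (s - k + (n - s)) = k * (s - k) + k * (n - s))%N; last first.
  by rewrite mulnDr.
rewrite (_ : q ^+ 'C(s, 2) = q ^+ ('C(k, 2) + 'C(s - k, 2) + k * (s - k)));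
  last by rewrite -bin2D subnKC.
rewrite (_ : (- c) ^+ s = (- c) ^+ k * (- c) ^+ (s - k)); last first.
  by rewrite -exprD subnKC.
rewrite mul2n -addnn !exprD.
rewrite (_ : - (_ * _) = (-1) * a * b * q ^+ (n - s)); last by ring.
rewrite -[- c]mulN1r !exprMn -exprM (mulnC k (n - s)%N).
have s1 : (-1) ^+ k * (-1) ^+ k = 1 :> K.
  by rewrite -expr2 -exprM mulnC exprM sqrrN expr1n expr1n.
ring: s1.
Qed.

End QAlgebra.

(** * The hypergeometric formula at regular parameters *)

Section Formula.
Context {K : numFieldType}.
Variable q : K.
Hypotheses (q_neq0 : q != 0) (q_not_root1 : forall k, q ^+ k.+1 != 1).
Implicit Types (a b c x z : K) (n k l : nat).

Lemma qpochs2 n x y : qpochs q n [:: x; y] = qpoch q n x * qpoch q n y.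
Proof. by rewrite /qpochs !big_cons big_nil mulr1. Qed.

Lemma qpochs3 n x y z :
  qpochs q n [:: x; y; z] = qpoch q n x * qpoch q n y * qpoch q n z.
Proof. by rewrite /qpochs !big_cons big_nil mulr1 mulrA. Qed.

Lemma limn_series_finite (u : nat -> K) n :
  (forall k, (n < k)%N -> u k = 0) -> limn (series u) = \sum_(k < n.+1) u k.
Proof.
move=> u0; apply: cvg_lim; first exact: norm_hausdorff.
apply: cvg_near_cst; near=> N.
have nN : (n < N)%N by near: N; exists n.+1.
rewrite /series/= (big_cat_nat (leq0n _) nN)/= big_mkord.
have -> : \sum_(n.+1 <= i < N) u i = 0.
  by rewrite big_nat big1// => i /andP[ni _]; exact: u0.
by rewrite addr0.
Unshelve. all: by end_near. Qed.

Lemma cdqHahn_formulaE n z a b c : cdqHahn_regular q n (a, b, c) ->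
  cdqHahn_formula q n z a b c = cdq_coef q a b c z n * qpoch q n q.
Proof.
move=> [/= a0 ab_reg ac_reg].
have ab0 k : (k <= n)%N -> qpoch q k (a * b) != 0.
  by move=> kn; apply/qpoch_neq0P => j jk; apply: ab_reg; exact: leq_trans jk kn.
have ac0 k : (k <= n)%N -> qpoch q k (a * c) != 0.
  by move=> kn; apply/qpoch_neq0P => j jk; apply: ac_reg; exact: leq_trans jk kn.
rewrite /cdqHahn_formula /qhyper (@limn_series_finite _ n); last first.
  move=> k nk; rewrite /qhyper_term qpochs3 -(subnKC nk) qpochD qpochS.
  by rewrite mulVf ?expf_neq0// subrr; ring.
rewrite mulr_sumr mulr_suml; apply: eq_bigr => k _.
have kn : (k <= n)%N by rewrite -ltnS.
rewrite /qhyper_term qpochs3 qpochs3 qpochs2 /= expr0z mulr1.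
rewrite -[in qpoch q n (a * b)](subnKC kn) -[in qpoch q n (a * c)](subnKC kn).
rewrite !qpochD.
rewrite /cdq_weight /inversion_weight /askey_basis exprD.
have := qpoch_qexpN q q_neq0 q_not_root1 n k kn; rewrite {1}/inv_qfact.
move=> /(canRL (mulfK _)) ->; last first.
  by rewrite invr_eq0 qpoch_qq_neq0.
rewrite /inv_qfact; field; rewrite ab0 ?ac0 ?qpoch_qq_neq0 ?expf_neq0//.
Qed.

End Formula.

(** * Absolutely summable sequences *)

Section AbsSummable.
Context {K : numFieldType}.

Definition abs_summable (u : nat -> K) :=
  exists M : K, forall n, \sum_(k < n) `|u k| <= M.

(** The form of completeness that the analysis below relies on.  Stating it as a
    predicate on the field keeps the rest free of real and imaginary parts. *)
Definition abs_summable_complete := forall u : nat -> K, abs_summable u ->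
  cvgn (series u) /\
  forall eps : K, 0 < eps -> exists N, forall n, \sum_(N <= k < n) `|u k| <= eps.
End AbsSummable.
Arguments abs_summable_complete : clear implicits.

Section ComplexSeries.
Context {R : realType}.
Local Notation C := R[i].
Local Notation Re := (@complex.Re R).
Local Notation Im := (@complex.Im R).
Implicit Types (u v : nat -> C).

Lemma posC (e : C) : 0 < e -> exists2 r : R, 0 < r & e = r%:C.
Proof.
case: e => r i; rewrite ltcE/= => /andP[/eqP -> r0]; by exists r.
Qed.

Lemma norm_lt_Re_Im (z : C) (e : R) :
  `|Re z| < e / 2 -> `|Im z| < e / 2 -> `|z| < e%:C.
Proof.
move=> re im; rewrite [z in `|z|]complexE (le_lt_trans (ler_normD _ _))//.
rewrite normrM.
have -> : `|'i : C| = 1 by rewrite normc_def/= expr0n/= expr1n add0r sqrtr1.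
rewrite mul1r.
have nR (x : R) : `|x%:C| = `|x|%:C :> C.
  by rewrite normc_def/= expr0n/= addr0 sqrtr_sqr.
by rewrite !nR -rmorphD/= ltcR; lra.
Qed.

Lemma cvg_complex u (l : C) :
  (fun n => Re (u n)) @ \oo --> Re l -> (fun n => Im (u n)) @ \oo --> Im l ->
  u @ \oo --> l.
Proof.
move=> /cvgrPdist_lt cr /cvgrPdist_lt ci; apply/cvgrPdist_lt => e /posC[r r0 ->].
have r20 : 0 < r / 2 by rewrite divr_gt0.
near=> n; apply: norm_lt_Re_Im; rewrite raddfB/=.
- by near: n; apply: cr.
- by near: n; apply: ci.
Unshelve. all: by end_near. Qed.

Lemma abs_summable_Re u : abs_summable u -> cvgn (series (fun k => Re `|u k|)).
Proof.
move=> [M uM]; apply: nondecreasing_is_cvgn.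
  apply/nondecreasing_seqP => n; rewrite /series/= big_nat_recr//= lerDl.
  by have := normr_ge0 (u n); rewrite lecE/= => /andP[].
exists (Re M) => _ [n _ <-]; have := uM n.
rewrite lecE => /andP[_]; rewrite raddf_sum/= /series/= big_mkord; exact.
Qed.

Lemma abs_summable_cvg u : abs_summable u -> cvgn (series u).
Proof.
move=> su; have sv := abs_summable_Re u su.
have dom (p : C -> R) : (forall z, `|p z| <= Re `|z|) ->
    cvgn (series (fun k => p (u k))).
  move=> pn; apply: normed_cvg; apply: (series_le_cvg _ _ _ sv) => n //=.
  exact: le_trans (pn _).
have reP (z : C) : `|Re z| <= Re `|z|.
  by have := normc_ge_Re z; rewrite lecE/= => /andP[].
have imP (z : C) : `|Im z| <= Re `|z|.
  have := reP (z * 'i); rewrite ReiNIm normrN normrM.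
  have -> : `|'i : C| = 1 by rewrite normc_def/= expr0n/= expr1n add0r sqrtr1.
  by rewrite mulr1.
apply/cvg_ex; exists (limn (series (fun k => Re (u k))) +i*
  limn (series (fun k => Im (u k)))).
apply: cvg_complex => /=.
  have := dom Re reP; rewrite /series/= => h.
  by under eq_fun do rewrite raddf_sum.
have := dom Im imP; rewrite /series/= => h.
by under eq_fun do rewrite raddf_sum.
Qed.

Lemma abs_summable_tail u (eps : C) : abs_summable u -> 0 < eps ->
  exists N, forall n, \sum_(N <= k < n) `|u k| <= eps.
Proof.
move=> su /posC[r r0 ->]; have cu := abs_summable_Re u su.
set S := series _ in cu.
have ndS : {homo S : n m / (n <= m)%N >-> n <= m}.
  apply/nondecreasing_seqP => n; rewrite /S /series/= big_nat_recr//= lerDl.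
  by have := normr_ge0 (u n); rewrite lecE/= => /andP[].
have /cvgrPdist_lt/(_ r r0)[N _ SN] := cu.
exists N => n; have [Nn|nN] := leqP N n; last first.
  by rewrite big_geq ?(ltnW nN)// lecE/= eqxx (ltW r0).
have -> : \sum_(N <= k < n) `|u k| = (S n - S N)%:C.
  rewrite /S /series/= (big_cat_nat (leq0n _) Nn)/= addrAC subrr add0r rmorph_sum/=.
  by apply: eq_bigr => k _; rewrite -[LHS]RRe_real ?normr_real.
rewrite lecR; have := SN N (leqnn N); rewrite /= => /ltr_normlW.
have := nondecreasing_cvgn_le ndS cu n; lra.
Qed.

Lemma complex_abs_summable_complete : abs_summable_complete C.
Proof.
move=> u su; split; first exact: abs_summable_cvg.
by move=> eps; exact: abs_summable_tail.
Qed.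

End ComplexSeries.

Section Series.
Context {K : numFieldType}.
Hypothesis Kcomplete : abs_summable_complete K.
Implicit Types (u v : nat -> K).

(** Tannery's theorem on the triangle [k < N]: the terms with large [k] are small
    uniformly in [N], as [d] is bounded and the tail of [u] is small; finitely
    many values of [k] remain, and each of these terms tends to [0]. *)
Lemma tannery_triangle u (d : nat -> nat -> K) (M : K) : abs_summable u ->
  (forall k n, `|d k n| <= M) -> (forall k, d k @ \oo --> 0) ->
  (fun N => \sum_(k < N) u k * d k (N - k)%N) @ \oo --> 0.
Proof.
move=> su dM d0; apply/cvgr0Pnorm_lt => eps eps0.
have M0 : 0 <= M by exact: le_trans (dM 0%N 0%N).
have M1 : 0 < M + 1 by rewrite ltr_wpDl.
have e2 : 0 < eps / 2 by rewrite divr_gt0.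
have [_ /(_ _ (divr_gt0 e2 M1))[N0 uN0]] := Kcomplete u su.
have head : (fun N => \sum_(k < N0) u k * d k (N - k)%N) @ \oo -->
    \sum_(k < N0) u k * 0.
  apply: cvg_big => [|k _]; first exact: add_continuous.
  apply: (@cvgM K _ \oo _ (fun=> u k) (fun n => d k (n - k)%N)).
    exact: cvg_cst.
  by rewrite (cvg_centern _ (d k)).
rewrite big1 in head; last by move=> k _; rewrite mulr0.
move/cvgr0Pnorm_lt : head => /(_ _ e2) head.
near=> N.
have NN : (N0 <= N)%N by near: N; exists N0.
rewrite -(big_mkord xpredT (fun k => u k * d k (N - k)%N)).
rewrite (big_cat_nat (leq0n _) NN)/= big_mkord.
rewrite [eps]splitr (le_lt_trans (ler_normD _ _))//.
apply: ltr_leD; first by near: N.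
apply: (le_trans (ler_norm_sum _ _ _)).
apply: (@le_trans _ _ (\sum_(N0 <= k < N) `|u k| * (M + 1))).
  apply: ler_sum => k _; rewrite normrM ler_wpM2l//.
  by apply: (le_trans (dM _ _)); rewrite lerDl.
by rewrite -mulr_suml -ler_pdivlMr.
Unshelve. all: by end_near. Qed.

(** The ratio test. *)
Lemma abs_summable_ratio u (c : nat -> K) (l : K) : (forall k, u k.+1 = c k * u k) ->
  c @ \oo --> l -> `|l| < 1 -> abs_summable u.
Proof.
move=> uS cl l1; pose r := `|l| + (1 - `|l|) / 2.
have l2 : 0 < (1 - `|l|) / 2 by rewrite divr_gt0// subr_gt0.
have r1 : 0 < 1 - r.
  by rewrite (_ : 1 - r = (1 - `|l|) / 2)// /r; field.
have /cvgrPdist_lt/(_ _ l2)[N0 _ cK] := cl.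
have cr k : (N0 <= k)%N -> `|c k| <= r.
  move=> /cK/= h; rewrite -[c k](subKr l) (le_trans (ler_normB _ _))// lerD2l.
  exact: ltW.
(* From N0 on, [`|u|] decreases at least like r ^+ n, so the quotient bounds the
   geometric tail; hence T is nonincreasing and bounds all partial sums. *)
pose T n := \sum_(k < N0 + n) `|u k| + `|u (N0 + n)%N| / (1 - r).
have TS n : T n.+1 <= T n.
  rewrite /T addnS big_ord_recr/= -addrA lerD2l uS normrM.
  apply: (@le_trans _ _ (`|u (N0 + n)%N| + r * `|u (N0 + n)%N| / (1 - r))).
    by rewrite lerD2l ler_wpM2r ?invr_ge0 ?(ltW r1)// ler_wpM2r// cr// leq_addr.
  rewrite le_eqVlt; apply/orP; left; apply/eqP; field; exact: lt0r_neq0.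
have T0 n : T n <= T 0%N by elim: n => // n; apply: le_trans.
exists (T 0%N) => n; apply: le_trans (T0 n); rewrite /T.
apply: (@le_trans _ _ (\sum_(k < N0 + n) `|u k|)); last first.
  by rewrite lerDl divr_ge0// ltW.
rewrite (big_ord_widen (N0 + n) (fun k => `|u k|)) ?leq_addl//.
rewrite [leRHS](bigID (fun i : 'I_(N0 + n) => (i < n)%N))/= lerDl.
exact: sumr_ge0.
Qed.

Lemma cvg_expr_norm_lt1 (q : K) : `|q| < 1 -> GRing.exp q @ \oo --> (0 : K).
Proof.
move=> q1; apply: cvg_series_cvg_0; apply: (Kcomplete _ _).1.
apply: (abs_summable_ratio _ (fun=> q) q) => // [k|]; first by rewrite exprS.
exact: cvg_cst.
Qed.

Lemma sum_triangle (X : nat -> nat -> K) N :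
  \sum_(n < N) \sum_(k < n.+1) X k (n - k)%N = \sum_(k < N) \sum_(m < N - k) X k m.
Proof.
case: N => [|N]; first by rewrite !big_ord0.
rewrite -(triangle_assoc (fun k m _ => X k m)); apply: eq_bigr => k _.
by rewrite subSn// -ltnS.
Qed.

(** Summation by diagonals of a double series [\sum_k u k \sum_m b k m] whose inner
    series may depend on [k]: the N-th partial sum by diagonals is a sum over a
    triangle, and it differs from the N-th partial sum of [u k * H k] by
    [\sum_(k < N) u k * d k (N - k)], with [d k] the error of the k-th inner
    series. *)
Lemma series_triangle u (b : nat -> nat -> K) (H : nat -> K) (M L : K) :
  abs_summable u -> (forall k n, \sum_(m < n) `|b k m| <= M) ->
  (forall k, series (b k) @ \oo --> H k) ->
  series (fun k => u k * H k) @ \oo --> L ->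
  series (fun n => \sum_(k < n.+1) u k * b k (n - k)%N) @ \oo --> L.
Proof.
move=> su bM bH uL.
have bM' k n : `|series (b k) n| <= M.
  by rewrite /series/= big_mkord (le_trans (ler_norm_sum _ _ _)).
have HM k : `|H k| <= M + 1.
  have /cvgrPdist_lt/(_ 1 ltr01)[n _ /(_ n (leqnn n))/= Hn] := bH k.
  rewrite -[H k](subrK (series (b k) n)) (le_trans (ler_normD _ _))// addrC lerD//.
  exact: ltW.
have d0 k : (fun n => series (b k) n - H k) @ \oo --> 0.
  by rewrite -(subrr (H k)); apply: cvgB => //; exact: cvg_cst.
have := tannery_triangle u (fun k n => series (b k) n - H k) (M + (M + 1)) su _ d0.
move=> /(_ _)/cvgD/(_ uL); rewrite add0r => h.
have {}h : (fun N => \sum_(k < N) u k * (series (b k) (N - k)%N - H k) +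
    series (fun k => u k * H k) N) @ \oo --> L.
  apply: h => k n; rewrite (le_trans (ler_normB _ _))// lerD//.
apply: cvg_trans h; apply: near_eq_cvg; near=> N.
rewrite /series/= !big_mkord -big_split/=.
rewrite (sum_triangle (fun k m => u k * b k m)); apply: eq_bigr => k _.
by rewrite -mulrDr subrK big_mkord mulr_sumr.
Unshelve. all: by end_near. Qed.

Definition abs_sums u (l : K) := abs_summable u /\ series u @ \oo --> l.

(** Mertens' theorem, for two absolutely convergent series. *)
Lemma abs_sums_cauchy_prod u v l m : abs_sums u l -> abs_sums v m ->
  abs_sums (cauchy_prod u v) (l * m).
Proof.
move=> [su ul] [[M vM] vm]; split; last first.
  apply: (series_triangle u (fun=> v) (fun=> m) M) => //.
  rewrite (_ : series _ = (fun n => series u n * m)); last first.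
    by apply/funext => n; rewrite /series/= mulr_suml.
  by apply: cvgM => //; exact: cvg_cst.
have [M' uM'] := su; exists (M' * M) => N.
have M0 : 0 <= M by have := vM 0%N; rewrite big_ord0.
apply: (@le_trans _ _ (\sum_(n < N) \sum_(k < n.+1) `|u k| * `|v (n - k)%N|)).
  apply: ler_sum => n _; apply: (le_trans (ler_norm_sum _ _ _)).
  by apply: ler_sum => k _; rewrite normrM.
rewrite (sum_triangle (fun k m => `|u k| * `|v m|)).
apply: (@le_trans _ _ (\sum_(k < N) `|u k| * M)).
  by apply: ler_sum => k _; rewrite -mulr_sumr ler_wpM2l.
by rewrite -mulr_suml ler_wpM2r.
Qed.

(** Continuity at [0] of the sum of a power series, along a sequence [y] in the
    closed unit disc. *)
Lemma power_series_cvg_at0 u (y S : nat -> K) : abs_summable u ->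
  (forall n, `|y n| <= 1) -> y @ \oo --> (0 : K) ->
  (forall n, series (fun k => u k * y n ^+ k) @ \oo --> S n) ->
  S @ \oo --> u 0%N.
Proof.
move=> [M uM] y1 y0 yS; apply/cvgrPdist_lt => eps eps0.
have e2 : 0 < eps / 2 by rewrite divr_gt0.
have M0 : 0 <= M by have := uM 0%N; rewrite big_ord0.
have M1 : 0 < M + 1 by rewrite ltr_wpDl.
move/cvgr0Pnorm_lt : y0 => /(_ _ (divr_gt0 e2 M1)) y0.
near=> n.
have yn : `|y n| < eps / 2 / (M + 1) by near: n.
have /cvgrPdist_lt/(_ _ e2)[N _ /(_ N.+1 (leqnSn N))/= SN] := yS n.
rewrite distrC -(subrK (series (fun k => u k * y n ^+ k) N.+1) (S n)) -addrA.
rewrite [eps]splitr (le_lt_trans (ler_normD _ _))// ltr_leD//.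
rewrite /series/= big_mkord big_ord_recl expr0 mulr1 addrAC subrr add0r.
apply: (le_trans (ler_norm_sum _ _ _)).
apply: (@le_trans _ _ (\sum_(i < N) `|u i.+1| * `|y n|)).
  apply: ler_sum => i _; rewrite lift0 normrM ler_wpM2l// exprS normrM.
  by rewrite ler_piMr// normrX exprn_ile1.
rewrite -mulr_suml mulrC; apply: (@le_trans _ _ (`|y n| * (M + 1))); last first.
  by rewrite -ler_pdivlMr// ltW.
rewrite ler_wpM2l//; apply: le_trans (_ : M <= _); last by rewrite lerDl.
by apply: le_trans (uM N.+1); rewrite big_ord_recl lerDr.
Unshelve. all: by end_near. Qed.

End Series.

(** * Euler's expansions of the infinite q-products *)

Section Euler.
Context {K : numFieldType}.
Hypothesis Kcomplete : abs_summable_complete K.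
Variable q : K.
Hypothesis q_lt1 : `|q| < 1.
Implicit Types (x y : K).

Lemma expq_neq1 k : q ^+ k.+1 != 1.
Proof.
apply: contraTneq q_lt1 => qk1; apply/negP => q1.
have : `|q ^+ k.+1| < 1 by rewrite normrX exprn_ilt1.
by rewrite qk1 normr1 ltxx.
Qed.
Let q_nr1 := expq_neq1.

Lemma cvg_const_expr x : (fun k => x * q ^+ k) @ \oo --> (0 : K).
Proof.
have h : (fun k => x * q ^+ k) @ \oo --> x * 0.
  by apply: cvgM; [exact: cvg_cst|exact: cvg_expr_norm_lt1].
by rewrite mulr0 in h.
Qed.

Lemma cvg_factor x : (fun k => 1 - x * q ^+ k) @ \oo --> (1 : K).
Proof.
have h : (fun k => 1 - x * q ^+ k) @ \oo --> 1 - (0 : K).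
  by apply: cvgB; [exact: cvg_cst|exact: cvg_const_expr].
by rewrite subr0 in h.
Qed.

Lemma cvg_factorV x : (fun k => (1 - x * q ^+ k)^-1) @ \oo --> (1 : K).
Proof.
rewrite -[X in _ --> X]invr1; apply: (@cvgV K _ \oo _ (fun k => 1 - x * q ^+ k)).
  exact: oner_neq0.
exact: cvg_factor.
Qed.

Lemma inv_qfactSE k : inv_qfact q k.+1 = (1 - q * q ^+ k)^-1 * inv_qfact q k.
Proof.
by rewrite (inv_qfactS q q_nr1 k) -exprS mulrCA mulVf ?mulr1// subq_neq0.
Qed.

Lemma abs_summable_geom x : `|x| < 1 ->
  abs_summable (fun k => inv_qfact q k * x ^+ k).
Proof.
move=> x1; apply: (abs_summable_ratio _ (fun k => x * (1 - q * q ^+ k)^-1) x) => //.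
  by move=> k; rewrite inv_qfactSE exprS; ring.
rewrite -[X in _ --> X]mulr1.
by apply: cvgM; [exact: cvg_cst|exact: cvg_factorV].
Qed.

Lemma qexp_coefS x k :
  qexp_coef q x k.+1 = - x * q ^+ k * (1 - q * q ^+ k)^-1 * qexp_coef q x k.
Proof. by rewrite /qexp_coef inv_qfactSE binS2 exprD exprS; ring. Qed.

Lemma abs_summable_qexp x : abs_summable (qexp_coef q x).
Proof.
apply: (abs_summable_ratio _ _ 0 (qexp_coefS x)); last by rewrite normr0.
rewrite -[X in _ --> X](mul0r 1).
by apply: cvgM; [exact: cvg_const_expr|exact: cvg_factorV].
Qed.

Definition qexp x := limn (series (qexp_coef q x)).
Definition qgeom x := limn (series (fun k => inv_qfact q k * x ^+ k)).

Lemma series_qexp x : series (qexp_coef q x) @ \oo --> qexp x.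
Proof. exact: (Kcomplete _ (abs_summable_qexp x)).1. Qed.

Lemma series_qgeom x : `|x| < 1 ->
  series (fun k => inv_qfact q k * x ^+ k) @ \oo --> qgeom x.
Proof. by move=> x1; exact: (Kcomplete _ (abs_summable_geom x x1)).1. Qed.

Lemma expq_le1 n : `|q ^+ n| <= 1.
Proof. by rewrite normrX exprn_ile1// ltW. Qed.

Lemma normXq x n : `|x| < 1 -> `|x * q ^+ n| < 1.
Proof.
move=> x1; rewrite normrM; apply: le_lt_trans x1.
by rewrite ler_piMr// expq_le1.
Qed.

(** Comparing coefficients: [f_(k+1)(x) - f_(k+1)(xq) = - x f_k(xq)]. *)
Lemma qexp_functional x : qexp x = (1 - x) * qexp (x * q).
Proof.
have E n : series (qexp_coef q x) n.+1 =
    series (qexp_coef q (x * q)) n.+1 - x * series (qexp_coef q (x * q)) n.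
  elim: n => [|n IHn].
    by rewrite /series/= !big_nat1 big_nil mulr0 subr0 /qexp_coef bin0n !expr0.
  rewrite seriesSr IHn !seriesSr.
  have -> : qexp_coef q x n.+1 =
      qexp_coef q (x * q) n.+1 - x * qexp_coef q (x * q) n.
    rewrite !qexp_coefZ /qexp_coef (inv_qfactS q q_nr1 n) binS2 exprD !exprS; ring.
  ring.
have h : (fun n => series (qexp_coef q x) n.+1) @ \oo -->
    qexp (x * q) - x * qexp (x * q).
  under eq_fun do rewrite E.
  apply: cvgB; first by rewrite (cvg_shiftS (series _)); exact: series_qexp.
  by apply: cvgM; [exact: cvg_cst|exact: series_qexp].
rewrite (cvg_shiftS (series _)) in h.
rewrite mulrBl mul1r; apply: cvg_unique h; [exact: norm_hausdorff|exact: series_qexp].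
Qed.

Lemma qexp_iter x n : qexp x = qpoch q n x * qexp (x * q ^+ n).
Proof.
elim: n => [|n IHn]; first by rewrite qpoch0 mul1r expr0 mulr1.
by rewrite [LHS]IHn qpochS -mulrA exprSr (mulrA x) -qexp_functional.
Qed.

Lemma qexp_cvg1 x : (fun n => qexp (x * q ^+ n)) @ \oo --> (1 : K).
Proof.
rewrite (_ : 1 = qexp_coef q x 0); last first.
  by rewrite /qexp_coef bin0n !expr0 inv_qfact0 !mulr1.
apply: (power_series_cvg_at0 _ (fun n => q ^+ n) _ (abs_summable_qexp x) expq_le1).
  exact: cvg_expr_norm_lt1.
by move=> n; under eq_fun do rewrite -qexp_coefZ; exact: series_qexp.
Qed.

(** Iterating the functional equation gives
    [(x; q)_n = qexp x / qexp (x q^n)], and [qexp] tends to [1] at [0]; so Euler's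
    series for the product also proves that the product converges. *)
Lemma qpoch_cvg x : (fun n => qpoch q n x) @ \oo --> qexp x.
Proof.
have h : (fun n => qexp x * (qexp (x * q ^+ n))^-1) @ \oo --> qexp x * 1^-1.
  apply: cvgM; first exact: cvg_cst.
  apply: (@cvgV K _ \oo _ (fun n => qexp (x * q ^+ n))).
    exact: oner_neq0.
  exact: qexp_cvg1.
rewrite invr1 mulr1 in h; apply: cvg_trans h; apply: near_eq_cvg.
have /cvgrPdist_lt/(_ _ ltr01) := qexp_cvg1 x; apply: filterS => n.
rewrite /= (qexp_iter x n) => F1; rewrite mulfK//.
by apply: contraTneq F1 => ->; rewrite subr0 normr1 ltxx.
Qed.

Lemma qpoch_ooE x : qpoch_oo q x = qexp x.
Proof. by apply: cvg_lim; [exact: norm_hausdorff|exact: qpoch_cvg]. Qed.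

Lemma qpoch_oo_iter x n : qpoch_oo q x = qpoch q n x * qpoch_oo q (x * q ^+ n).
Proof. by rewrite !qpoch_ooE -qexp_iter. Qed.

Lemma abs_sums_qexp x : abs_sums (qexp_coef q x) (qpoch_oo q x).
Proof. by split; [exact: abs_summable_qexp|rewrite qpoch_ooE; exact: series_qexp]. Qed.

Lemma qgeom_functional x : `|x| < 1 -> (1 - x) * qgeom x = qgeom (x * q).
Proof.
move=> x1; set u := fun x k => inv_qfact q k * x ^+ k.
have E n : series (u (x * q)) n.+1 = series (u x) n.+1 - x * series (u x) n.
  elim: n => [|n IHn].
    by rewrite /series/= !big_nat1 big_nil mulr0 subr0 /u !expr0.
  rewrite seriesSr IHn !seriesSr.
  by rewrite /u exprMn (inv_qfactS q q_nr1 n) !exprS; ring.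
have h : (fun n => series (u (x * q)) n.+1) @ \oo --> qgeom x - x * qgeom x.
  under eq_fun do rewrite E.
  apply: cvgB; first by rewrite (cvg_shiftS (series _)); exact: series_qgeom.
  by apply: cvgM; [exact: cvg_cst|exact: series_qgeom].
rewrite (cvg_shiftS (series _)) in h.
rewrite mulrBl mul1r; apply: cvg_unique h _; first exact: norm_hausdorff.
by apply: series_qgeom; have := normXq x 1 x1; rewrite expr1.
Qed.

Lemma qgeom_iter x n : `|x| < 1 -> qpoch q n x * qgeom x = qgeom (x * q ^+ n).
Proof.
move=> x1; elim: n => [|n IHn]; first by rewrite qpoch0 mul1r expr0 mulr1.
by rewrite qpochS mulrAC IHn mulrC qgeom_functional ?normXq// -mulrA -exprSr.
Qed.

Lemma qpoch_oo_qgeom x : `|x| < 1 -> qpoch_oo q x * qgeom x = 1.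
Proof.
move=> x1.
have h : (fun n => qpoch q n x * qgeom x) @ \oo --> qpoch_oo q x * qgeom x.
  by rewrite qpoch_ooE; apply: cvgM; [exact: qpoch_cvg|exact: cvg_cst].
suff h1 : (fun n => qpoch q n x * qgeom x) @ \oo --> (1 : K).
  by apply: cvg_unique h h1; exact: norm_hausdorff.
rewrite (_ : (fun n => _) = (fun n => qgeom (x * q ^+ n))); last first.
  by apply/funext => n; exact: qgeom_iter.
rewrite (_ : 1 = inv_qfact q 0 * x ^+ 0); last by rewrite expr0 inv_qfact0 mulr1.
apply: (power_series_cvg_at0 _ (fun n => q ^+ n) _ (abs_summable_geom x x1) expq_le1).
  exact: cvg_expr_norm_lt1.
move=> n; under eq_fun do rewrite -mulrA -exprMn.
exact/series_qgeom/normXq.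
Qed.

Lemma abs_sums_geom x : `|x| < 1 ->
  abs_sums (fun k => inv_qfact q k * x ^+ k) (qpoch_oo q x)^-1.
Proof.
move=> x1; split; first exact: abs_summable_geom.
have E := qpoch_oo_qgeom x x1.
have n0 : qpoch_oo q x != 0.
  by apply: contra_eq_neq E => ->; rewrite mul0r eq_sym oner_neq0.
by rewrite -[_^-1]mulr1 -E mulKf//; exact: series_qgeom.
Qed.

End Euler.

(** * The generating function of the cleared formula *)

Section GeneratingFunction.
Context {K : numFieldType}.
Hypothesis Kcomplete : abs_summable_complete K.
Variable q : K.
Hypotheses (q_neq0 : q != 0) (q_lt1 : `|q| < 1).
Implicit Types (a b c x z s t : K).
Let q_nr1 := expq_neq1 q q_lt1.

Lemma qpoch_oo_neq0 x : `|x| < 1 -> qpoch_oo q x != 0.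
Proof.
move=> x1; apply: contra_eq_neq (qpoch_oo_qgeom Kcomplete q q_lt1 x x1) => ->.
by rewrite mul0r eq_sym oner_neq0.
Qed.

(** The products are nested as in [cdq_product_coef], whose generating function
    this is. *)
Definition cdq_product a b c z s : K :=
  qpoch_oo q (c * s) * (qpoch_oo q (b * s) * (qpoch_oo q (a * s) *
    (qpoch_oo q (s * z))^-1 * (qpoch_oo q (s * z^-1))^-1)).

Lemma abs_sums_cdq_product a b c z s : `|s * z| < 1 -> `|s * z^-1| < 1 ->
  abs_sums (fun n => cdq_product_coef q a b c z n * s ^+ n)
    (cdq_product a b c z s).
Proof.
move=> sz sVz.
have geomE y : (fun k => inv_qfact q k * y ^+ k * s ^+ k) =
    (fun k => inv_qfact q k * (s * y) ^+ k).
  by apply/funext => k; rewrite exprMn; ring.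
have expE y : (fun k => qexp_coef q y k * s ^+ k) = qexp_coef q (y * s).
  by apply/funext => k; rewrite qexp_coefZ.
have scaleE (u v : nat -> K) : (fun n => cauchy_prod u v n * s ^+ n) =
    cauchy_prod (fun k => u k * s ^+ k) (fun k => v k * s ^+ k).
  by apply/funext => n; rewrite cauchy_prod_scale.
rewrite /cdq_product_coef /big_qhermite_coef.
have -> : (fun k => inv_qfact q k * z ^- k) = (fun k => inv_qfact q k * (z^-1) ^+ k).
  by apply/funext => k; rewrite exprVn.
rewrite !scaleE !expE !geomE.
by do !apply: abs_sums_cauchy_prod => //; (exact: abs_sums_qexp || exact: abs_sums_geom).
Qed.

Lemma abs_summable_square w :
  abs_summable (fun k => q ^+ (2 * 'C(k, 2)) * w ^+ k * inv_qfact q k).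
Proof.
apply: (abs_summable_ratio _
  (fun k => w * q ^+ k * (1 * q ^+ k) * (1 - q * q ^+ k)^-1) 0).
- move=> k; rewrite inv_qfactSE// binS2 mulnDr exprD.
  by rewrite mul2n -addnn exprD mul2n -addnn exprD exprS; ring.
- rewrite -[X in _ --> X](mul0r 1) -[X in X * 1](mul0r 0).
  by apply: cvgM; [apply: cvgM; exact: cvg_const_expr|exact: cvg_factorV].
- by rewrite normr0.
Qed.

Lemma qhyper_term23 x y a b c w k :
  qhyper_term q [:: x; y] [:: a; b; c] w k =
  qpoch q k x * qpoch q k y / (qpoch q k q * qpoch q k a * qpoch q k b * qpoch q k c)
  * q ^+ (2 * 'C(k, 2)) * w ^+ k.
Proof.
rewrite /qhyper_term qpochs2 (_ : 1 + _ - _ = 2%N :> int)//.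
have -> : ((-1) ^+ k * q ^+ 'C(k, 2)) ^ 2%N = q ^+ (2 * 'C(k, 2)).
  change (((-1) ^+ k * q ^+ 'C(k, 2)) ^+ 2 = q ^+ (2 * 'C(k, 2))).
  by rewrite exprMn -exprM mulnC exprM sqrrN !expr1n mul1r -exprM mulnC.
by rewrite /qpochs !big_cons big_nil mulr1 !mulrA.
Qed.

Lemma qhyper23_cvg x y a b c w :
  series (qhyper_term q [:: x; y] [:: a; b; c] w) @ \oo -->
  qhyper q [:: x; y] [:: a; b; c] w.
Proof.
apply: (Kcomplete _ _).1.
pose F u k := 1 - u * q ^+ k.
apply: (abs_summable_ratio _ (fun k => w * q ^+ k * (1 * q ^+ k) *
  (F x k * F y k) * ((F q k)^-1 * (F a k)^-1 * (F b k)^-1 * (F c k)^-1)) 0).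
- move=> k; rewrite !qhyper_term23 !qpochS !invfM binS2 mulnDr exprD.
  by rewrite (mul2n k) -addnn exprD exprS /F; ring.
- rewrite -[X in _ --> X](mul0r (1 * 1 * 1 * 1)).
  rewrite -[X in X * (1 * 1 * 1 * 1)](mul0r (1 * 1)).
  rewrite -[X in X * (1 * 1) * _](mul0r 0).
  apply: cvgM; last by do !apply: cvgM; exact: cvg_factorV.
  by do !apply: cvgM; (exact: cvg_factor || exact: cvg_const_expr).
- by rewrite normr0.
Qed.

Lemma cdq_product_shift a b c z t k :
  (forall k, a * t != q ^- k) -> (forall k, b * t != q ^- k) ->
  (forall k, c * t != q ^- k) -> `|t * z| < 1 -> `|t * z^-1| < 1 ->
  qpochs_oo q [:: a * t; b * t; c * t] / qpochs_oo q [:: t * z; t * z^-1] *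
    qhyper_term q [:: t * z; t * z^-1] [:: a * t; b * t; c * t] (a * b * c * t) k =
  q ^+ (2 * 'C(k, 2)) * (a * b * c * t) ^+ k * inv_qfact q k *
    cdq_product a b c z (t * q ^+ k).
Proof.
move=> at_reg bt_reg ct_reg tz tVz.
have reg x : (forall j, x != q ^- j) -> qpoch q k x != 0.
  move=> xr; apply/qpoch_neq0P => j _; apply: contra_neq (xr j) => h.
  by rewrite -[x](mulfK (expf_neq0 j q_neq0)) h mul1r.
have small x : `|x| < 1 -> qpoch q k x != 0.
  move=> x1; apply/qpoch_neq0P => j _; have := normXq q q_lt1 x j x1.
  by apply: contraTneq => ->; rewrite normr1 ltxx.
rewrite qhyper_term23 /qpochs_oo !big_cons !big_nil !mulr1 /cdq_product.
have iter x := qpoch_oo_iter Kcomplete q q_lt1 x k.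
rewrite (iter (a * t)) (iter (b * t)) (iter (c * t)) (iter (t * z)).
rewrite (iter (t / z)) /inv_qfact.
rewrite !(mulrA _ t) -!(mulrAC t _ (q ^+ k)).
move: (qpoch_oo_neq0 _ (normXq q q_lt1 _ k tz)).
move: (qpoch_oo_neq0 _ (normXq q q_lt1 _ k tVz)).
move: (reg _ at_reg) (reg _ bt_reg) (reg _ ct_reg) (small _ tz) (small _ tVz).
move: (qpoch_qq_neq0 q q_nr1 k).
move: (qpoch_oo q _) (qpoch_oo q _) => P Q *.
by field; do ?[apply/andP; split].
Qed.

Lemma cdq_generating_function a b c z t : a != 0 -> z != 0 ->
  (forall k, a * t != q ^- k) -> (forall k, b * t != q ^- k) ->
  (forall k, c * t != q ^- k) -> `|t * z| < 1 -> `|t * z^-1| < 1 ->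
  series (fun n => t ^+ n * cdq_coef q a b c z n) @ \oo -->
    qpochs_oo q [:: a * t; b * t; c * t] / qpochs_oo q [:: t * z; t * z^-1]
    * qhyper q [:: t * z; t * z^-1] [:: a * t; b * t; c * t] (a * b * c * t).
Proof.
move=> a0 z0 at_reg bt_reg ct_reg tz tVz.
pose g := cdq_product_coef q a b c z.
pose u k := q ^+ (2 * 'C(k, 2)) * (a * b * c * t) ^+ k * inv_qfact q k.
have [[M gM] _] := abs_sums_cdq_product a b c z t tz tVz.
have -> : (fun n => t ^+ n * cdq_coef q a b c z n) =
    (fun n => \sum_(k < n.+1) u k * (g (n - k)%N * (t * q ^+ k) ^+ (n - k))).
  apply/funext => n; rewrite cdq_coefE// mulr_sumr; apply: eq_bigr => k _.
  rewrite -[in t ^+ n](@subnKC k n) -1?ltnS// exprD /u /g !exprMn -exprM; ring.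
apply: (series_triangle Kcomplete u (fun k m => g m * (t * q ^+ k) ^+ m)
    (fun k => cdq_product a b c z (t * q ^+ k)) M).
- exact: abs_summable_square.
- move=> k n; apply: le_trans (gM n); apply: ler_sum => m _.
  rewrite !normrM ler_wpM2l// exprMn normrM ler_piMr//.
  by rewrite normrX exprn_ile1// expq_le1.
- by move=> k; apply: (abs_sums_cdq_product _ _ _ _ _ _ _).2; rewrite mulrAC normXq.
- have -> : (fun k => u k * cdq_product a b c z (t * q ^+ k)) = fun k =>
      qpochs_oo q [:: a * t; b * t; c * t] / qpochs_oo q [:: t * z; t * z^-1] *
      qhyper_term q [:: t * z; t * z^-1] [:: a * t; b * t; c * t] (a * b * c * t) k.
    by apply/funext => k; rewrite cdq_product_shift.
  set p := _ / _; set h := qhyper_term _ _ _ _.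
  rewrite (_ : series _ = (fun n => p * series h n)); last first.
    by apply/funext => n; rewrite /series/= mulr_sumr.
  by apply: cvgM; [exact: cvg_cst|exact: qhyper23_cvg].
Qed.

End GeneratingFunction.

(** * Extension by continuity to all parameters *)

Section ContinuousExtension.
Context {K : numFieldType}.
Variable q : K.
Hypotheses (q_neq0 : q != 0) (q_lt1 : `|q| < 1).
Hypothesis Kcomplete : abs_summable_complete K.
Implicit Types (a b c x z s t : K).
Let q_nr1 := expq_neq1 q q_lt1.

Lemma qpoch_cts (T : Type) (F : set_system T) (f : T -> K) (l : K) n : Filter F ->
  f @ F --> l -> (fun p => qpoch q n (f p)) @ F --> qpoch q n l.
Proof.
move=> FF fl; apply: cvg_big => [|i _]; first exact: mul_continuous.
apply: cvgB; first exact: cvg_cst.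
by apply: cvgM => //; exact: cvg_cst.
Qed.

Lemma cvg_exprn_fun (T : Type) (F : set_system T) (f : T -> K) (l : K) n :
  Filter F ->
  f @ F --> l -> (fun p => f p ^+ n) @ F --> l ^+ n.
Proof.
move=> FF fl; elim: n => [|n IHn]; first exact: cvg_cst.
under eq_fun do rewrite exprS.
by rewrite exprS; apply: cvgM.
Qed.

Lemma cdq_coef_cts n a b c z : a != 0 ->
  (fun p : K * K * K => cdq_coef q p.1.1 p.1.2 p.2 z n) @ nbhs (a, b, c) -->
  cdq_coef q a b c z n.
Proof.
move=> a0.
have ca : (fun p : K * K * K => p.1.1) @ nbhs (a, b, c) --> a.
  by apply: (cvg_comp (@fst (K * K)%type K) fst); exact: cvg_fst.
have cb : (fun p : K * K * K => p.1.2) @ nbhs (a, b, c) --> b.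
  by apply: (cvg_comp (@fst (K * K)%type K) snd); [exact: cvg_fst|exact: cvg_snd].
have cc : (fun p : K * K * K => p.2) @ nbhs (a, b, c) --> c by exact: cvg_snd.
apply: cvg_big => [|k _]; first exact: add_continuous.
rewrite /cdq_weight /askey_basis.
repeat (apply: cvgM || apply: qpoch_cts || exact: cvg_cst || done).
apply: (@cvgV K _ _ _ (fun p : K * K * K => p.1.1 ^+ n)); first by rewrite expf_neq0.
exact: cvg_exprn_fun.
Qed.

Lemma cvg_near_neq (u : nat -> K) l y : u @ \oo --> l -> l != y ->
  \forall n \near \oo, u n != y.
Proof.
move=> /cvgrPdist_lt ul ly; have ly0 : 0 < `|l - y| by rewrite normr_gt0 subr_eq0.
by have := ul _ ly0; apply: filterS => n; apply: contraTneq => ->; rewrite ltxx.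
Qed.

(** Regular parameters accumulate at every [(a, b, c)] with [a] nonzero, so that
    limits along them are unique: [(a, b (1 + q^m), c (1 + q^m))] is regular for
    large [m].  If [ab q^k = 1] the perturbed value is [1 + q^m], never [1];
    otherwise it converges to [ab q^k], which differs from [1]. *)
Lemma within_regular_proper n a b c : a != 0 ->
  ProperFilter (within (cdqHahn_regular q n) (nbhs (a, b, c))).
Proof.
move=> a0; apply: Build_ProperFilter_ex => A wA.
have perturb y : (fun m => y * (1 + q ^+ m)) @ \oo --> y.
  have h : (fun m => y * (1 + q ^+ m)) @ \oo --> y * (1 + 0).
    apply: cvgM; first exact: cvg_cst.
    by apply: cvgD; [exact: cvg_cst|exact: cvg_expr_norm_lt1].
  by rewrite addr0 mulr1 in h.
have avoid y (k : nat) : \forall m \near \oo, a * (y * (1 + q ^+ m)) * q ^+ k != 1.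
  have [y1|y1] := eqVneq (a * y * q ^+ k) 1.
    apply: nearW => m; rewrite mulrA mulrAC y1 mul1r -subr_eq0 addrC addKr.
    exact: expf_neq0.
  apply: cvg_near_neq y1; apply: cvgM; last exact: cvg_cst.
  by apply: cvgM; [exact: cvg_cst|exact: perturb].
have pcvg : (fun m => (a, b * (1 + q ^+ m), c * (1 + q ^+ m))) @ \oo --> (a, b, c).
  have ca : (fun=> a) @ \oo --> a by exact: cvg_cst.
  exact: cvg_pair (cvg_pair ca (perturb b)) (perturb c).
near \oo => m.
exists (a, b * (1 + q ^+ m), c * (1 + q ^+ m)).
have : cdqHahn_regular q n (a, b * (1 + q ^+ m), c * (1 + q ^+ m)).
  split=> //= k kn.
    suff /(_ (Ordinal kn)) :
      forall i : 'I_n, a * (b * (1 + q ^+ m)) * q ^+ i != 1 by [].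
    by near: m; apply: filter_forall => i; exact: avoid.
  suff /(_ (Ordinal kn)) :
    forall i : 'I_n, a * (c * (1 + q ^+ m)) * q ^+ i != 1 by [].
  by near: m; apply: filter_forall => i; exact: avoid.
by near: m; exact: (pcvg _ wA).
Unshelve. all: by end_near. Qed.

Lemma joukowskiP x z : z != 0 -> x = (z + z^-1) / 2 ->
  joukowski_inv x = z \/ joukowski_inv x = z^-1.
Proof.
move=> z0 xE; rewrite /joukowski_inv; case: xgetP => [w _ [w0 xw]|/(_ z) []//].
have : (w - z) * (w * z - 1) = 0.
  have : w + w^-1 = z + z^-1.
    by apply: (mulIf (_ : 2^-1 != 0)); rewrite ?invr_eq0 ?pnatr_eq0// -xE.
  move=> /(congr1 (fun y => y * (w * z))) h.
  have -> : (w - z) * (w * z - 1) = (w + w^-1) * (w * z) - (z + z^-1) * (w * z).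
    by field; apply/andP.
  by rewrite h subrr.
move/eqP; rewrite mulf_eq0 !subr_eq0 => /orP[/eqP->|/eqP wz]; first by left.
by right; rewrite -[w](mulfK z0) wz mul1r.
Qed.

Lemma cdqHahnE n x a b c z : a != 0 -> z != 0 -> x = (z + z^-1) / 2 ->
  cdqHahn q n x a b c = cdq_coef q a b c z n * qpoch q n q.
Proof.
move=> a0 z0 xE.
have coefV : cdq_coef q a b c (joukowski_inv x) n = cdq_coef q a b c z n.
  have [->//|->] := joukowskiP x z z0 xE.
  by apply: eq_bigr => k _; rewrite /askey_basis invrK; ring.
rewrite -coefV; have PF := within_regular_proper n a b c a0.
apply: cvg_lim; first exact: norm_hausdorff.
have h : (fun p : K * K * K =>
      cdq_coef q p.1.1 p.1.2 p.2 (joukowski_inv x) n * qpoch q n q)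
    @ within (cdqHahn_regular q n) (nbhs (a, b, c)) -->
    cdq_coef q a b c (joukowski_inv x) n * qpoch q n q.
  apply: cvgM; last exact: cvg_cst.
  by apply: cvg_trans (cdq_coef_cts n a b c _ a0); apply: cvg_app; exact: cvg_within.
apply: cvg_trans h; apply: near_eq_cvg.
rewrite near_withinE; apply: nearW => -[[a' b'] c'] /= reg.
by rewrite cdqHahn_formulaE.
Qed.

End ContinuousExtension.

Theorem theorem6p6 (R : realType) (q z x a b c t : R[i])
    (q_gt0 : 0 < `|q|) (q_lt1 : `|q| < 1)
    (z_neq0 : z != 0) (xE : x = (z + z^-1) / 2) (x_neq0 : x != 0)
    (a_neq0 : a != 0) (b_neq0 : b != 0) (c_neq0 : c != 0)
    (tz_lt1 : `|t * z| < 1) (tVz_lt1 : `|t * z^-1| < 1)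
    (at_reg : forall k : nat, a * t != q ^- k)
    (bt_reg : forall k : nat, b * t != q ^- k)
    (ct_reg : forall k : nat, c * t != q ^- k) :
  series (fun n : nat => t ^+ n * cdqHahn q n x a b c / qpoch q n q) @ \oo -->
    qpochs_oo q [:: a * t; b * t; c * t] / qpochs_oo q [:: t * z; t * z^-1]
    * qhyper q [:: t * z; t * z^-1] [:: a * t; b * t; c * t] (a * b * c * t).
Proof.
have q0 : q != 0 by rewrite -normr_gt0.
have Ccomplete := @complex_abs_summable_complete R.
have -> : (fun n => t ^+ n * cdqHahn q n x a b c / qpoch q n q) =
    (fun n => t ^+ n * cdq_coef q a b c z n).
  apply/funext => n; rewrite (cdqHahnE q q0 q_lt1 Ccomplete n x a b c z)//.
  by rewrite mulrA mulfK// qpoch_qq_neq0//; exact: expq_neq1.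
exact: (cdq_generating_function Ccomplete).
Qed.
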